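(* Let $\Phi$ be an irreducible finite crystallographic root system and let $\alpha,\alpha'\in\Phi_{\ge-1}$ be such that $(\alpha\|\alpha')=(\alpha'\|\alpha)=1$. If $[\alpha\boxplus\alpha':\alpha_i]>0$ for some $i\in I$, then $[\alpha+\alpha':\alpha_i]>0$.
   Context: $\Phi$ has rank $n$, simple roots $\Pi=\{\alpha_i:i\in I\}$, positive roots $\Phi_{>0}$, root lattice $Q=\mathbb{Z}\Pi$, ambient space $Q_\mathbb{R}$, Cartan matrix $(a_{ij})$ with $s_i(\alpha_j)=\alpha_j-a_{ij}\alpha_i$; $[\alpha:\alpha_i]$ is the coefficient of $\alpha_i$ in $\alpha$. $I=I_+\sqcup I_-$ is the bipartition of the tree Coxeter graph. For $\varepsilon=\pm$, $\tau_\varepsilon:Q_\mathbb{R}\to Q_\mathbb{R}$ is given by $[\tau_\varepsilon\alpha:\alpha_i]=-[\alpha:\alpha_i]-\sum_{j\ne i}a_{ij}\max([\alpha:\alpha_j],0)$ for $i\in I_\varepsilon$, $[\tau_\varepsilon\alpha:\alpha_i]=[\alpha:\alpha_i]$ otherwise. $\Phi_{\ge-1}=\Phi_{>0}\cup(-\Pi)$. The compatibility degree is the unique nonnegative-integer function $(\alpha\|\beta)$ on $\Phi_{\ge-1}^2$ with $(-\alpha_i\|\alpha)=\max([\alpha:\alpha_i],0)$ and $(\tau_\varepsilon\alpha\|\tau_\varepsilon\beta)=(\alpha\|\beta)$. For $n>1$ and $(\alpha\|\alpha')=(\alpha'\|\alpha)=1$, the set $E(\alpha,\alpha')=\{\sigma(\sigma^{-1}\alpha+\sigma^{-1}\alpha'):\sigma\in\langle\tau_+,\tau_-\rangle\}$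 consists of exactly two elements of $Q$, namely $\alpha+\alpha'$ and another one denoted $\alpha\boxplus\alpha'$. For $n=1$ (type $A_1$), set $\alpha\boxplus\alpha'=0$. *)

(* Defs.v *)
From HB Require Import structures.
From mathcomp Require Import all_boot all_order all_algebra.
From mathcomp Require Import reals.

Set Implicit Arguments.
Unset Strict Implicit.
Unset Printing Implicit Defensive.

Import Order.TTheory GRing.Theory Num.Theory.
Local Open Scope ring_scope.

Section RootSystems.

Variables (R : realType) (V : vectType R).

Section Roots.

Variables (dot : {dot V for idfun}) (Phi : seq V).

Definition reflection (a b : V) : V := b - (2 * dot a b / dot a a) *: a.

(* Reduced crystallographic root system; Phi is used only through membership,
   so its order and repetitions are irrelevant. *)
Record root_system : Prop := RootSystem {
  root_span : <<Phi>>%VS = fullv;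
  root_neq0 : 0 \notin Phi;
  root_reduced : forall (a : V) (x : R),
    a \in Phi -> x *: a \in Phi -> x = 1 \/ x = -1;
  root_reflection : forall a b : V,
    a \in Phi -> b \in Phi -> reflection a b \in Phi;
  root_crystallographic : forall a b : V,
    a \in Phi -> b \in Phi -> 2 * dot a b / dot a a \is a Num.int }.

Definition irreducible_roots : Prop :=
  (exists a : V, a \in Phi) /\
  forall P : pred V,
    (exists2 a : V, a \in Phi & P a) ->
    (exists2 b : V, b \in Phi & ~~ P b) ->
    exists a b : V,
      [/\ a \in Phi, b \in Phi, P a, ~~ P b & dot a b != 0].

Variables (n : nat) (Pi : n.-tuple V).

Record simple_roots : Prop := SimpleRoots {
  simple_sub : {subset Pi <= Phi};
  simple_basis : basis_of fullv Pi;
  simple_sign : forall b : V, b \in Phi ->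
    (forall i : 'I_n, coord Pi i b \is a Num.nat) \/
    (forall i : 'I_n, - coord Pi i b \is a Num.nat) }.

(* The index order is that of s_i(alpha_j) = alpha_j - a_ij alpha_i. *)
Definition cartan (i j : 'I_n) : R :=
  2 * dot (tnth Pi i) (tnth Pi j) / dot (tnth Pi i) (tnth Pi i).

(* I_+ is the set where eps is true, I_- the set where it is false. *)
Definition coxeter_bipartition (eps : 'I_n -> bool) : Prop :=
  forall i j : 'I_n, i != j -> cartan i j != 0 -> eps i != eps j.

Definition positive_root (b : V) : bool :=
  (b \in Phi) && [forall i : 'I_n, 0 <= coord Pi i b].

(* Membership in Phi_{>= -1}. *)
Definition almost_positive_root (b : V) : bool :=
  positive_root b || [exists i : 'I_n, b == - tnth Pi i].

Variable eps : 'I_n -> bool.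

Definition tau (e : bool) (v : V) : V :=
  \sum_(i < n)
    (if eps i == e then
       - coord Pi i v
       - \sum_(j < n | j != i) cartan i j * Num.max (coord Pi j v) 0
     else coord Pi i v) *: tnth Pi i.

Definition compatibility_degree (deg : V -> V -> nat) : Prop :=
  (forall (i : 'I_n) (b : V), almost_positive_root b ->
     (deg (- tnth Pi i) b)%:R = Num.max (coord Pi i b) 0) /\
  (forall (e : bool) (a b : V),
     almost_positive_root a -> almost_positive_root b ->
     deg (tau e a) (tau e b) = deg a b).

(* The group of bijections of V generated by tau_+ and tau_-. *)
Inductive tau_group : (V -> V) -> Prop :=
| tau_group_id : tau_group id
| tau_group_gen (e : bool) : tau_group (tau e)
| tau_group_comp (s t : V -> V) :
    tau_group s -> tau_group t -> tau_group (s \o t)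
| tau_group_inv (s t : V -> V) :
    tau_group s -> cancel s t -> cancel t s -> tau_group t.

Definition exchange_set (a a' y : V) : Prop :=
  exists s t : V -> V,
    [/\ tau_group s, cancel s t, cancel t s & y = s (t a + t a')].

(* For n > 1 the exchange set of an exchangeable pair has exactly two
   elements, so that this determines y. *)
Definition is_boxplus (a a' y : V) : Prop :=
  if n == 1%N then y = 0 else exchange_set a a' y /\ y <> a + a'.

End Roots.

End RootSystems.

(* Main.v *)
(* More is true: every coordinate of every element of the group generated by
   tau_+ and tau_- is subadditive on the root lattice, so that
   [s (t a + t a') : alpha_i] <= [a + a' : alpha_i] whenever t is the inverse
   of s; root systems enter only through the signs of the Cartan matrix.

   The maps tau_e are the tropicalisations of the steps of the Y-system
   y_i -> y_i^-1 \prod_j (1 + y_j)^|a_ij|.  The iterates of a coordinate under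
   these steps are Laurent polynomials in y, by induction on the number of
   steps: if f and f o tau_e o tau_-e are Laurent, the only possible denominators
   of f o tau_e o tau_-e o tau_e are powers of 1 + y_k with eps k <> e, and these
   do not occur because the three steps map the point (1, .., -1, .., 1) of the
   hyperplane y_k = -1 to a point with finite nonzero coordinates.  Restricting
   a Laurent polynomial f to the surface y_i = q^(u_i) r^(v_i) gives a Laurent
   polynomial in q and r.  Its degree in q is the tropical value at u, its degree
   in r is the one at v, and its growth along q = r is the one at u + v; the last
   is at most the sum of the first two. *)

Require Import Defs.
From HB Require Import structures.
From mathcomp Require Import all_boot all_order all_algebra.
From mathcomp Require Import polyXY reals boolp.
From mathcomp Require Import ring lra zify.

Set Implicit Arguments.
Unset Strict Implicit.
Unset Printing Implicit Defensive.

Import Order.TTheory GRing.Theory Num.Theory.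
Local Open Scope ring_scope.

(** * Polynomial functions *)

Lemma poly_eq0_inj (R : idomainType) (p : {poly R}) (t : nat -> R) :
  injective t -> (forall k, p.[t k] = 0) -> p = 0.
Proof.
move=> t_inj pt0; apply: (@roots_geq_poly_eq0 _ _ (map t (iota 0 (size p)))).
- by apply/allP => _ /mapP[k _ ->]; rewrite /root pt0.
- by rewrite map_inj_uniq ?iota_uniq.
- by rewrite size_map size_iota.
Qed.

Section PolynomialFunctions.

Variables (R : realFieldType) (n : nat).
Implicit Types (y z : 'I_n -> R) (f g : ('I_n -> R) -> R) (i j k : 'I_n).

Inductive polyfun : (('I_n -> R) -> R) -> Prop :=
| polyfun_const c : polyfun (fun _ => c)
| polyfun_var i : polyfun (fun y => y i)
| polyfunD f g : polyfun f -> polyfun g -> polyfun (fun y => f y + g y)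
| polyfunM f g : polyfun f -> polyfun g -> polyfun (fun y => f y * g y).

(** Induction on [f] for any class [C] closed under sums and products. It is applied with [C] the
    polynomial functions, univariate polynomials along a line, Laurent functions, regular functions,
    and Laurent polynomials in two variables. *)
Lemma polyfun_subst (T : Type) (C : (T -> R) -> Prop) (Y : T -> 'I_n -> R) f :
  (forall c, C (fun _ => c)) ->
  (forall u v : T -> R, C u -> C v -> C (fun t => u t + v t)) ->
  (forall u v : T -> R, C u -> C v -> C (fun t => u t * v t)) ->
  (forall i, C (fun t => Y t i)) ->
  polyfun f -> C (fun t => f (Y t)).
Proof.
move=> CC CD CM CY; elim=> [c|i|f1 f2 _ H1 _ H2|f1 f2 _ H1 _ H2].
- exact: CC.
- exact: CY.
- exact: CD.
- exact: CM.
Qed.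

Lemma polyfunX f m : polyfun f -> polyfun (fun y => f y ^+ m).
Proof.
move=> pf; elim: m => [|m IH]; first exact: polyfun_const.
rewrite (_ : (fun _ => _) = (fun y => f y * f y ^+ m)); first exact: polyfunM.
by apply/funext => y; rewrite exprS.
Qed.

Lemma polyfun_prod (F : 'I_n -> ('I_n -> R) -> R) :
  (forall i, polyfun (F i)) -> polyfun (fun y => \prod_i F i y).
Proof.
move=> pF.
suff H s : polyfun (fun y => \prod_(i <- s) F i y) by exact: H.
elim: s => [|i s IH].
  rewrite (_ : (fun _ => _) = (fun=> 1)); first exact: polyfun_const.
  by apply/funext => y; rewrite big_nil.
rewrite (_ : (fun _ => _) = (fun y => F i y * \prod_(i <- s) F i y)).
  exact: polyfunM.
by apply/funext => y; rewrite big_cons.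
Qed.

Definition upd k (c : R) y : 'I_n -> R := fun i => if i == k then c else y i.

Lemma polyfun_upd k c f : polyfun f -> polyfun (fun y => f (upd k c y)).
Proof.
apply: (polyfun_subst (C := polyfun) (Y := upd k c));
  [exact: polyfun_const|exact: polyfunD|exact: polyfunM|].
by move=> i; rewrite /upd; case: (i == k);
  [exact: polyfun_const|exact: polyfun_var].
Qed.

(** Division with remainder by [1 + y k]: the remainder is the restriction to the hyperplane
    [y k = -1]. For a product, the difference telescopes, one factor being replaced at a time. *)
Lemma polyfun_factor k f : polyfun f ->
  exists2 g, polyfun g & forall y, f y = f (upd k (-1) y) + (1 + y k) * g y.
Proof.
elim=> [c|i|f1 f2 p1 [g1 q1 H1] p2 [g2 q2 H2]|f1 f2 p1 [g1 q1 H1] p2 [g2 q2 H2]].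
- by exists (fun=> 0); [exact: polyfun_const|move=> y; rewrite mulr0 addr0].
- exists (fun=> if i == k then 1 else 0); first exact: polyfun_const.
  by move=> y; rewrite /upd; case: eqP => [->|_]; ring.
- exists (fun y => g1 y + g2 y); first exact: polyfunD.
  by move=> y; rewrite (H1 y) (H2 y); ring.
- exists (fun y => f1 (upd k (-1) y) * g2 y + g1 y * f2 y).
    by apply: polyfunD; apply: polyfunM => //; exact: polyfun_upd.
  by move=> y; rewrite (H1 y) (H2 y); ring.
Qed.

Lemma polyfun_line f y z : polyfun f ->
  exists p : {poly R}, forall t, f (fun i => y i + t * z i) = p.[t].
Proof.
move=> pf; have := @polyfun_subst R (fun h => exists p : {poly R}, forall t, h t = p.[t])
  (fun t i => y i + t * z i) f.
apply=> //.
- by move=> c; exists c%:P => t; rewrite hornerC.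
- by move=> f1 f2 [p1 H1] [p2 H2]; exists (p1 + p2) => t; rewrite hornerD H1 H2.
- by move=> f1 f2 [p1 H1] [p2 H2]; exists (p1 * p2) => t; rewrite hornerM H1 H2.
- by move=> i; exists ((y i)%:P + 'X * (z i)%:P) => t; rewrite !hornerE.
Qed.

Definition posv y := forall i, 0 < y i.

(** The line from the point with all coordinates 1 towards [y] stays in the positive orthant for
    small parameters, so the univariate restriction of [f] has infinitely many roots. *)
Lemma polyfun_pos_eq0 f :
  polyfun f -> (forall y, posv y -> f y = 0) -> forall y, f y = 0.
Proof.
move=> pf f0 y; have [p Hp] := polyfun_line (fun=> 1) (fun i => y i - 1) pf.
(* Parameters [t <= 1 / M] keep [1 + t * (y i - 1)] positive for every [i]. *)
pose M := 1 + \sum_i `|y i - 1|.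
have leM i : `|y i - 1| < M.
  rewrite /M (bigD1 i) //=; have : 0 <= \sum_(j < n | j != i) `|y j - 1|.
    by apply: sumr_ge0.
  by move: (`|_|) (\sum_(_ < _ | _) _) => u v; lra.
have M0 : 0 < M by rewrite ltr_pwDl // sumr_ge0.
have p0 : p = 0.
  apply: (@poly_eq0_inj R p (fun k : nat => (M + k%:R)^-1)) => [k l /invr_inj|k].
    by move/addrI/eqP; rewrite eqr_nat => /eqP.
  rewrite -Hp f0 // => i; have Mk : 0 < M + k%:R by rewrite ltr_wpDr.
  rewrite -(pmulr_rgt0 _ Mk) mulrDr mulr1 mulrA divff ?mul1r ?gt_eqF //.
  have := leM i; have : 0 <= k%:R :> R by [].
  by move: (k%:R) (ler_normr (y i - 1) (1 - y i)) => kk; rewrite ltr_norml; lra.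
have := Hp 1; rewrite p0 horner0 => <-; congr f; apply/funext => i; ring.
Qed.

(** On the line through [y] and [z] both functions become univariate polynomials with zero product;
    that of [f] is nonzero because of its value at parameter 0. *)
Lemma polyfun_mul_eq0 f g y : polyfun f -> polyfun g ->
  (forall z, f z * g z = 0) -> f y != 0 -> forall z, g z = 0.
Proof.
move=> pf pg fg0 fy0 z.
have [p Hp] := polyfun_line y (fun i => z i - y i) pf.
have [q Hq] := polyfun_line y (fun i => z i - y i) pg.
have /eqP : p * q = 0.
  apply: (@poly_eq0_inj R (p * q) (fun k : nat => k%:R)) => [k l /eqP|k].
    by rewrite eqr_nat => /eqP.
  by rewrite hornerM -Hp -Hq fg0.
rewrite mulf_eq0 => /orP[] /eqP pq0.
  move: fy0; have := Hp 0; rewrite pq0 horner0.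
  by under [X in f X]funext do rewrite mul0r addr0; move=> ->; rewrite eqxx.
have := Hq 1; rewrite pq0 horner0 => <-; congr g; apply/funext => i; ring.
Qed.

End PolynomialFunctions.

(** * Laurent polynomial functions *)

Section LaurentFunctions.

Variables (R : realFieldType) (n : nat).
Implicit Types (y pt : 'I_n -> R) (f g : ('I_n -> R) -> R) (i j k : 'I_n).

(** Only values on the positive orthant count, and one exponent [m] clears all the variables at
    once. *)
Definition laurent f := exists (p : ('I_n -> R) -> R) (m : nat),
  polyfun p /\ forall y, posv y -> f y * (\prod_i y i) ^+ m = p y.

Lemma laurent_ext f g :
  (forall y, posv y -> f y = g y) -> laurent f -> laurent g.
Proof.
by move=> fg [p [m [pp H]]]; exists p, m; split=> // y y0; rewrite -fg ?H.
Qed.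

Lemma laurent_polyfun f : polyfun f -> laurent f.
Proof. by move=> pf; exists f, 0; split=> // y _; rewrite expr0 mulr1. Qed.

Lemma polyfun_prodvarX m : polyfun (fun y : 'I_n -> R => (\prod_i y i) ^+ m).
Proof. by apply: polyfunX; apply: polyfun_prod => i; exact: polyfun_var. Qed.

Lemma laurentD f g : laurent f -> laurent g -> laurent (fun y => f y + g y).
Proof.
move=> [p [m [pp Hp]]] [q [l [pq Hq]]].
exists (fun y => p y * (\prod_i y i) ^+ l + q y * (\prod_i y i) ^+ m), (m + l)%N.
split=> [|y y0]; last by rewrite -Hp // -Hq // exprD; ring.
by apply: polyfunD; apply: polyfunM => //; exact: polyfun_prodvarX.
Qed.

Lemma laurentM f g : laurent f -> laurent g -> laurent (fun y => f y * g y).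
Proof.
move=> [p [m [pp Hp]]] [q [l [pq Hq]]].
exists (fun y => p y * q y), (m + l)%N; split; first exact: polyfunM.
by move=> y y0; rewrite -Hp // -Hq // exprD; ring.
Qed.

Lemma laurent_const c : laurent (fun _ => c).
Proof. exact/laurent_polyfun/polyfun_const. Qed.

Lemma laurent_var i : laurent (fun y => y i).
Proof. exact/laurent_polyfun/polyfun_var. Qed.

Lemma laurentV i : laurent (fun y => (y i)^-1).
Proof.
exists (fun y => \prod_j (if j == i then 1 else y j)), 1; split.
  apply: polyfun_prod => j; case: (j == i);
    [exact: polyfun_const|exact: polyfun_var].
move=> y y0; rewrite expr1 (bigD1 i) //= mulKf ?gt_eqF //.
rewrite [RHS](bigD1 i) //= eqxx mul1r; apply: eq_bigr => j /negPf -> //.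
Qed.

Lemma laurentX f m : laurent f -> laurent (fun y => f y ^+ m).
Proof.
move=> lf; elim: m => [|m IH].
  by apply: laurent_ext (laurent_const 1) => y _; rewrite expr0.
by apply: laurent_ext (laurentM lf IH) => y _; rewrite exprS.
Qed.

Lemma laurent_prod (F : 'I_n -> ('I_n -> R) -> R) :
  (forall i, laurent (F i)) -> laurent (fun y => \prod_i F i y).
Proof.
move=> lF; suff H s : laurent (fun y => \prod_(i <- s) F i y) by exact: H.
elim: s => [|i s IH].
  by apply: laurent_ext (laurent_const 1) => y _; rewrite big_nil.
by apply: laurent_ext (laurentM (lF i) IH) => y _; rewrite big_cons.
Qed.

Lemma laurent_subst f (Y : ('I_n -> R) -> 'I_n -> R) :
  polyfun f -> (forall i, laurent (fun y => Y y i)) ->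
  laurent (fun y => f (Y y)).
Proof.
move=> pf lY; apply: polyfun_subst pf => //.
- exact: laurent_const.
- exact: laurentD.
- exact: laurentM.
Qed.

(* [f] is, on the positive orthant, a rational function that is defined at [pt]
   with value [c]; [pt] itself need not be positive. *)
Definition regular_at pt f c := exists N D : ('I_n -> R) -> R,
  [/\ polyfun N, polyfun D, D pt != 0, N pt = c * D pt &
      forall y, posv y -> f y * D y = N y].

Section Regular.

Variable pt : 'I_n -> R.
Local Notation reg := (regular_at pt).

Lemma reg_ext f g c :
  (forall y, posv y -> f y = g y) -> reg f c -> reg g c.
Proof.
move=> fg [N [D [pN pD D0 Nc H]]]; exists N, D; split=> // y y0.
by rewrite -fg ?H.
Qed.

Lemma reg_polyfun f : polyfun f -> reg f (f pt).
Proof.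
move=> pf; exists f, (fun=> 1); split=> //; rewrite ?oner_eq0 ?mulr1 //.
- exact: polyfun_const.
- by move=> y _; rewrite mulr1.
Qed.

Lemma reg_const c : reg (fun=> c) c.
Proof. by apply: (reg_polyfun (f := fun=> c)); exact: polyfun_const. Qed.

Lemma reg_var i : reg (fun y => y i) (pt i).
Proof. by apply: (reg_polyfun (f := fun y => y i)); exact: polyfun_var. Qed.

Lemma regD f g c d : reg f c -> reg g d -> reg (fun y => f y + g y) (c + d).
Proof.
move=> [N [D [pN pD D0 Nc H]]] [N' [D' [pN' pD' D0' Nc' H']]].
exists (fun y => N y * D' y + N' y * D y), (fun y => D y * D' y); split.
- by apply: polyfunD; exact: polyfunM.
- exact: polyfunM.
- by rewrite mulf_neq0.
- by rewrite Nc Nc'; ring.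
- by move=> y y0; rewrite -H // -H' //; ring.
Qed.

Lemma regM f g c d : reg f c -> reg g d -> reg (fun y => f y * g y) (c * d).
Proof.
move=> [N [D [pN pD D0 Nc H]]] [N' [D' [pN' pD' D0' Nc' H']]].
exists (fun y => N y * N' y), (fun y => D y * D' y); split.
- exact: polyfunM.
- exact: polyfunM.
- by rewrite mulf_neq0.
- by rewrite Nc Nc'; ring.
- by move=> y y0; rewrite -H // -H' //; ring.
Qed.

Lemma regV f c : (forall y, posv y -> f y != 0) -> c != 0 ->
  reg f c -> reg (fun y => (f y)^-1) c^-1.
Proof.
move=> f0 c0 [N [D [pN pD D0 Nc H]]]; exists D, N; split=> //.
- by rewrite Nc mulf_neq0.
- by rewrite Nc mulKf.
- by move=> y y0; rewrite -H // mulKf ?f0.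
Qed.

(** The predicate records what is known of the value at [pt]: positive, nonnegative, nonzero, or
    merely that it exists. The same closure lemmas then serve all four. *)
Definition reg_in (P : R -> Prop) f := exists2 c, P c & reg f c.

Lemma reg_in_ext P f g :
  (forall y, posv y -> f y = g y) -> reg_in P f -> reg_in P g.
Proof. by move=> fg [c Pc rf]; exists c => //; exact: reg_ext rf. Qed.

Section MulClosed.

Variable P : R -> Prop.
Hypotheses (P1 : P 1) (PM : forall c d, P c -> P d -> P (c * d)).

Lemma reg_inM f g :
  reg_in P f -> reg_in P g -> reg_in P (fun y => f y * g y).
Proof.
by move=> [c Pc rf] [d Pd rg]; exists (c * d); [exact: PM|exact: regM].
Qed.

Lemma reg_in1 : reg_in P (fun=> 1).
Proof. by exists 1 => //; exact: reg_const. Qed.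

Lemma reg_inX f m : reg_in P f -> reg_in P (fun y => f y ^+ m).
Proof.
move=> rf; elim: m => [|m IH].
  by apply: reg_in_ext reg_in1 => y _; rewrite expr0.
by apply: reg_in_ext (reg_inM rf IH) => y _; rewrite exprS.
Qed.

Lemma reg_in_prod (Q : pred 'I_n) (F : 'I_n -> ('I_n -> R) -> R) :
  (forall i, Q i -> reg_in P (F i)) ->
  reg_in P (fun y => \prod_(i | Q i) F i y).
Proof.
move=> rF; suff H s : reg_in P (fun y => \prod_(i <- s | Q i) F i y) by exact: H.
elim: s => [|i s IH].
  by apply: reg_in_ext reg_in1 => y _; rewrite big_nil.
case Qi: (Q i); last by apply: reg_in_ext IH => y _; rewrite big_cons Qi.
by apply: reg_in_ext (reg_inM (rF i Qi) IH) => y _; rewrite big_cons Qi.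
Qed.

End MulClosed.

End Regular.

Definition minus_one_at k : 'I_n -> R := upd k (-1) (fun=> 1).

(* A denominator [1 + y k] is removed at once if the function is regular at a
   single point of the hyperplane [y k = -1], because the hyperplane is
   irreducible. *)
Lemma laurent_clear_denominators g (d : 'I_n -> nat) :
  laurent (fun y => g y * \prod_j (1 + y j) ^+ d j) ->
  (forall k, (0 < d k)%N -> exists c, regular_at (minus_one_at k) g c) ->
  laurent g.
Proof.
have [s] := ubnP (\sum_j d j)%N; elim: s d => // s IH d ltds lg rg.
have [k dk|d0] := pickP (fun k => 0 < d k)%N; last first.
  apply: laurent_ext lg => y _; rewrite big1 ?mulr1 // => j _.
  by have := d0 j; rewrite lt0n => /negbFE/eqP ->.
(* One factor [1 + y k] is removed at a time; the induction is on the sum of the exponents. *)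
pose d' j := if j == k then (d k).-1 else d j.
have prodE y : \prod_j (1 + y j) ^+ d j =
               (1 + y k) * \prod_j (1 + y j) ^+ d' j.
  rewrite (bigD1 k) //= [in RHS](bigD1 k) //= /d' eqxx mulrA -exprS prednK //.
  by congr (_ * _); apply: eq_bigr => j /negPf ->.
apply: (IH d').
- move: ltds; rewrite ltnS; apply: leq_trans; rewrite (bigD1 k) //=.
  rewrite [X in (_ < X)%N](bigD1 k) //=.
  rewrite /d' eqxx -addSn prednK // leq_add2l.
  by apply/eq_leq/eq_bigr => j /negPf ->.
- have [c [N [D [pN pD D0 Nc HN]]]] := rg _ dk.
  have [P [m [pP HP]]] := lg; have [P' pP' HP'] := polyfun_factor k pP.
  exists P', m; split=> // y y0; apply: (@mulfI _ (1 + y k)).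
    by rewrite gt_eqF // addr_gt0.
  suff P0 : P (upd k (-1) y) = 0.
    have := HP' y; rewrite P0 add0r => <-; rewrite -HP // prodE; ring.
  (* On the hyperplane the product of [D] and [P] vanishes, while [D] is nonzero at
     [minus_one_at k], which is the image of the constant point 1 under [upd k (-1)]. *)
  apply: (@polyfun_mul_eq0 _ _ (fun y => D (upd k (-1) y)) (fun y => P (upd k (-1) y))
            (fun=> 1)) => [|||//]; [exact: polyfun_upd|exact: polyfun_upd|].
  (* Two expressions for [g], cross-multiplied: [G] vanishes on the positive orthant, hence
     everywhere. At [z k = -1] its second term carries the factor [1 + z k = 0]. *)
  pose G z := D z * P z - N z * (\prod_j (1 + z j) ^+ d j) * (\prod_i z i) ^+ m.
  have G0 z : G z = 0.
    apply: polyfun_pos_eq0 => [|x x0]; last by rewrite /G -HN // -HP //; ring.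
    rewrite (_ : G = fun z => D z * P z +
      (-1) * (N z * (\prod_j (1 + z j) ^+ d j) * (\prod_i z i) ^+ m)).
      apply: polyfunD; first exact: polyfunM.
      apply: polyfunM; first exact: polyfun_const.
      apply: polyfunM; last exact: polyfun_prodvarX.
      apply: polyfunM => //; apply: polyfun_prod => j; apply: polyfunX.
      by apply: polyfunD; [exact: polyfun_const|exact: polyfun_var].
    by apply/funext => x; rewrite mulN1r.
  move=> z; have := G0 (upd k (-1) z); rewrite /G prodE.
  have -> : 1 + upd k (-1) z k = 0 by rewrite /upd eqxx subrr.
  by rewrite !(mul0r, mulr0) subr0.
- move=> j dj; apply: rg; move: dj; rewrite /d'; case: eqP => [->|//].
  by case: (d k).
Qed.

End LaurentFunctions.

(** * The Laurent phenomenon for bipartite Y-systems *)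

Section YSystem.

Variables (R : realFieldType) (n : nat) (eps : 'I_n -> bool).
Variable A : 'I_n -> 'I_n -> nat.
Hypothesis A_bip : forall i j, A i j != 0%N -> eps i != eps j.
Hypothesis A_sym : forall i j, A i j != 0%N -> A j i != 0%N.
Implicit Types (y : 'I_n -> R) (f g h : ('I_n -> R) -> R) (i j k : 'I_n).
Implicit Types (e : bool) (w : seq bool).

Definition ystep e y : 'I_n -> R := fun i =>
  if eps i == e then (y i)^-1 * \prod_j (1 + y j) ^+ A i j else y i.

Definition yrun w y := foldl (fun z e => ystep e z) y w.

Lemma A_same i j : eps i = eps j -> A i j = 0%N.
Proof. by move=> eij; apply/eqP; apply/negPn/negP => /A_bip; rewrite eij eqxx. Qed.

Lemma ystep_pos e y : posv y -> posv (ystep e y).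
Proof.
move=> y0 i; rewrite /ystep; case: ifP => // _; rewrite mulr_gt0 ?invr_gt0 //.
by apply: prodr_gt0 => j _; rewrite exprn_gt0 // addr_gt0.
Qed.

Lemma ystep_fix e y i : eps i != e -> ystep e y i = y i.
Proof. by rewrite /ystep => /negPf ->. Qed.

Lemma ystep_mut e y i : eps i = e ->
  ystep e y i = (y i)^-1 * \prod_j (1 + y j) ^+ A i j.
Proof. by rewrite /ystep => ->; rewrite eqxx. Qed.

(** An index of sign [e] interacts only with indices of the other sign; these are fixed by the step,
    so both applications invert with the same product. *)
Lemma ystepK e y : posv y -> ystep e (ystep e y) = y.
Proof.
move=> y0; apply/funext => i; have [ei|ei] := eqVneq (eps i) e; last first.
  by rewrite !ystep_fix.
rewrite ystep_mut // ystep_mut // invfM invrK -mulrA mulrC -[RHS]mul1r.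
congr (_ * _); rewrite mulrC.
rewrite (eq_bigr (fun j => (1 + y j) ^+ A i j)) => [|j _].
  rewrite mulfV // gt_eqF //; apply: prodr_gt0 => j _.
  by rewrite exprn_gt0 // addr_gt0.
have [->|/A_bip] := eqVneq (A i j) 0%N; first by rewrite !expr0.
by rewrite ei eq_sym => /ystep_fix ->.
Qed.

Lemma laurent_ystep e i : laurent (fun y => ystep e y i).
Proof.
rewrite /ystep; case: (eps i == e); last exact: laurent_var.
apply: laurentM; first exact: laurentV.
apply: laurent_prod => j; apply: laurentX.
by apply: laurentD; [exact: laurent_const|exact: laurent_var].
Qed.

(** The denominator of [h] is a power of the product of the coordinates. After the step this product
    is, up to a monomial, a product of powers of [1 + y j] with [eps j != e]. *)
Lemma laurent_ystep_denominators e h : laurent h ->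
  exists2 d : 'I_n -> nat, (forall j, (0 < d j)%N -> eps j != e) &
    laurent (fun y => h (ystep e y) * \prod_j (1 + y j) ^+ d j).
Proof.
move=> [H [m [pH HH]]].
pose D j := (\sum_(i | eps i == e) A i j)%N.
(* The monomial that cancels the factors [(y i)^-1] of mutated coordinates and the coordinates left
   fixed. *)
pose u y i := if eps i == e then y i else (y i)^-1.
have prodE y : posv y ->
    \prod_i ystep e y i * \prod_i u y i = \prod_j (1 + y j) ^+ D j.
  move=> y0; rewrite -big_split /=.
  rewrite (eq_bigr (fun i => \prod_j (if eps i == e then (1 + y j) ^+ A i j else 1))).
    rewrite exchange_big /=; apply: eq_bigr => j _; rewrite /D.
    by rewrite -big_mkcond prodrXr.
  move=> i _; rewrite /ystep /u; case: ifP => _.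
    by rewrite mulrC mulVKf // gt_eqF.
  by rewrite mulfV ?gt_eqF // big1.
exists (fun j => D j * m)%N.
  move=> j; rewrite muln_gt0 => /andP[Dj _]; apply/negP => /eqP ej.
  move: Dj; rewrite /D big1 // => i /eqP ei; apply: A_same; congruence.
apply: (@laurent_ext _ _ (fun y => H (ystep e y) * (\prod_i u y i) ^+ m)).
  move=> y y0; rewrite -HH; last exact: ystep_pos.
  rewrite -mulrA -exprMn prodE // -prodrXl; congr (_ * _).
  by apply: eq_bigr => j _; rewrite exprM.
apply: laurentM; first by apply: laurent_subst => // i; exact: laurent_ystep.
apply: laurentX; apply: laurent_prod => i; rewrite /u.
by case: (eps i == e); [exact: laurent_var|exact: laurentV].
Qed.

(** * Regularity of three alternating steps at a point with [y k = -1] *)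

Section RegularAtMinusOne.

Variables (e : bool) (k : 'I_n).
Hypothesis ek : eps k != e.
Let pt : 'I_n -> R := minus_one_at R k.
Let z1 y := ystep e y.
Let z2 y := ystep (~~ e) (z1 y).
Let z3 y := ystep e (z2 y).
Let pos (c : R) : Prop := 0 < c.
Let nneg (c : R) : Prop := 0 <= c.
Let nz (c : R) : Prop := c != 0.

Let pos1 : pos 1. Proof. exact: ltr01. Qed.
Let posM c d : pos c -> pos d -> pos (c * d). Proof. exact: mulr_gt0. Qed.
Let nneg1 : nneg 1. Proof. exact: ler01. Qed.
Let nnegM c d : nneg c -> nneg d -> nneg (c * d). Proof. exact: mulr_ge0. Qed.
Let nz1 : nz 1. Proof. exact: oner_neq0. Qed.
Let nzM c d : nz c -> nz d -> nz (c * d). Proof. exact: mulf_neq0. Qed.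

Let reg_inW (P Q : R -> Prop) f :
  (forall c, P c -> Q c) -> reg_in pt P f -> reg_in pt Q f.
Proof. by move=> PQ [c /PQ Qc rf]; exists c. Qed.

Let pos_nneg c : pos c -> nneg c. Proof. exact: ltW. Qed.
Let pos_nz c : pos c -> nz c. Proof. by move=> c0; rewrite /nz gt_eqF. Qed.

Let reg_in1D f : reg_in pt nneg f -> reg_in pt pos (fun y => 1 + f y).
Proof.
move=> [c c0 rf]; exists (1 + c); first by rewrite /pos ltr_pwDl.
by apply: regD rf; exact: reg_const.
Qed.

Let reg_in_varpos i : i != k -> reg_in pt pos (fun y => y i).
Proof.
move=> ik; exists 1 => //; have := reg_var pt i.
by rewrite {2}/pt /minus_one_at /upd (negPf ik).
Qed.

Let reg_in_varVk : reg_in pt nz (fun y => (y k)^-1).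
Proof.
exists (-1)^-1; first by rewrite /nz invr_eq0 oppr_eq0 oner_eq0.
apply: regV; first by move=> y y0; rewrite gt_eqF.
  by rewrite oppr_eq0 oner_eq0.
by have := reg_var pt k; rewrite {2}/pt /minus_one_at /upd eqxx.
Qed.

Let reg_in_1Dk : reg_in pt (fun c => c = 0) (fun y => 1 + y k).
Proof.
exists 0 => //; have := regD (reg_const pt 1) (reg_var pt k).
by rewrite {2}/pt /minus_one_at /upd eqxx subrr.
Qed.

Let reg_inV (P : R -> Prop) f : (forall c, P c -> P c^-1) ->
  (forall c, P c -> c != 0) -> (forall y, posv y -> 0 < f y) ->
  reg_in pt P f -> reg_in pt P (fun y => (f y)^-1).
Proof.
move=> PV P0 f0 [c Pc rf]; exists c^-1; first exact: PV.
by apply: regV => //; [move=> y y0; rewrite gt_eqF ?f0|exact: P0].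
Qed.

Let posV c : pos c -> pos c^-1. Proof. by rewrite /pos invr_gt0. Qed.
Let nzV c : nz c -> nz c^-1. Proof. by rewrite /nz invr_eq0. Qed.

(** For [eps i = e], the coordinate [z1 y i] stripped of its power of [1 + y k], the only factor
    that vanishes at [pt]. *)
Let w i y := (y i)^-1 * \prod_(j | j != k) (1 + y j) ^+ A i j.

Let z1E i y : eps i = e -> z1 y i = w i y * (1 + y k) ^+ A i k.
Proof.
move=> ei; rewrite /z1 ystep_mut // /w -mulrA; congr (_ * _).
by rewrite (bigD1 k) //= mulrC.
Qed.

Let w_gt0 i y : posv y -> 0 < w i y.
Proof.
move=> y0; rewrite mulr_gt0 ?invr_gt0 //; apply: prodr_gt0 => j _.
by rewrite exprn_gt0 // addr_gt0.
Qed.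

Let neq_k i : eps i = e -> i != k.
Proof. by move=> ei; apply: contra_neq ek => <-. Qed.

Let reg_w i : eps i = e -> reg_in pt pos (w i).
Proof.
move=> ei; apply: reg_inM => //.
  by apply: reg_inV => //; exact/reg_in_varpos/neq_k.
apply: reg_in_prod => // j jk; apply: reg_inX => //.
by apply: reg_in1D; apply: reg_inW (reg_in_varpos jk).
Qed.

Let reg_z1 i : eps i = e -> reg_in pt nneg (fun y => z1 y i).
Proof.
move=> ei; apply: (@reg_in_ext _ _ _ _ (fun y => w i y * (1 + y k) ^+ A i k)).
  by move=> y _; rewrite z1E.
apply: reg_inM => //; first exact: reg_inW (reg_w ei).
by apply: reg_inX => //; apply: reg_inW reg_in_1Dk => c ->; exact: lexx.
Qed.

(** The neighbours [i] of [j] have sign [e], and there [z1] is nonnegative at [pt], so [1 + z1 y i]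
    cannot vanish. *)
Let reg_1z1X i j : eps j != e -> reg_in pt pos (fun y => (1 + z1 y i) ^+ A j i).
Proof.
move=> ej; have [->|Aji] := eqVneq (A j i) 0%N.
  by apply: reg_in_ext (reg_in1 pt pos1) => y _; rewrite expr0.
apply: reg_inX => //; apply/reg_in1D/reg_z1.
by move: (A_bip Aji) ej; case: (eps i) (eps j) (e) => [] [] [].
Qed.

Let z2E j y : eps j != e -> z2 y j = (y j)^-1 * \prod_i (1 + z1 y i) ^+ A j i.
Proof.
move=> ej; rewrite /z2 ystep_mut; last by move: ej; case: (eps j) (e) => [] [].
by congr (_^-1 * _); rewrite /z1 ystep_fix.
Qed.

Let reg_z2 j : eps j != e -> j != k -> reg_in pt pos (fun y => z2 y j).
Proof.
move=> ej jk.
apply: (@reg_in_ext _ _ _ _ (fun y => (y j)^-1 * \prod_i (1 + z1 y i) ^+ A j i)).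
  by move=> y _; rewrite z2E.
apply: reg_inM => //; last by apply: reg_in_prod => // i _; exact: reg_1z1X.
by apply: reg_inV => //; exact: reg_in_varpos.
Qed.

Let reg_z2k : reg_in pt nz (fun y => z2 y k).
Proof.
apply: (@reg_in_ext _ _ _ _ (fun y => (y k)^-1 * \prod_i (1 + z1 y i) ^+ A k i)).
  by move=> y _; rewrite z2E.
apply: reg_inM => //; apply: (reg_inW pos_nz).
by apply: reg_in_prod => // i _; exact: reg_1z1X.
Qed.

(** Congruence to 1 modulo [1 + y k]; the sign of the cofactor at [pt] is kept because [1 + S] must
    later be nonzero there. *)
Let one_plus g := exists2 S, reg_in pt nneg S &
  forall y, posv y -> g y = 1 + (1 + y k) * S y.

Let one_plus_ext f g :
  (forall y, posv y -> f y = g y) -> one_plus f -> one_plus g.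
Proof. by move=> fg [S rS HS]; exists S => // y y0; rewrite -fg ?HS. Qed.

Let one_plus1 : one_plus (fun=> 1).
Proof.
exists (fun=> 0); last by move=> y _; rewrite mulr0 addr0.
by exists 0; [exact: lexx|exact: reg_const].
Qed.

Let one_plusM f g : one_plus f -> one_plus g -> one_plus (fun y => f y * g y).
Proof.
move=> [S [c c0 rS] HS] [T [d d0 rT] HT].
exists (fun y => (S y + T y) + (1 + y k) * (S y * T y)).
  exists ((c + d) + 0 * (c * d)).
    by rewrite mul0r addr0; exact: addr_ge0.
  apply: regD; first exact: regD.
  by apply: regM; [have [_ -> //] := reg_in_1Dk|exact: regM].
by move=> y y0; rewrite HS // HT //; ring.
Qed.

Let one_plus_E : one_plus (fun y => \prod_i (1 + z1 y i) ^+ A k i).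
Proof.
suff H s : one_plus (fun y => \prod_(i <- s) (1 + z1 y i) ^+ A k i) by exact: H.
elim: s => [|i s IH].
  by apply: one_plus_ext one_plus1 => y _; rewrite big_nil.
apply: (@one_plus_ext (fun y => (1 + z1 y i) ^+ A k i *
                      \prod_(j <- s) (1 + z1 y j) ^+ A k j)).
  by move=> y _; rewrite big_cons.
apply: one_plusM => //; have [->|Aki] := eqVneq (A k i) 0%N.
  by apply: one_plus_ext one_plus1 => y _; rewrite expr0.
elim: (A k i) => [|m IHm].
  by apply: one_plus_ext one_plus1 => y _; rewrite expr0.
apply: (@one_plus_ext (fun y => (1 + z1 y i) * (1 + z1 y i) ^+ m)).
  by move=> y _; rewrite exprS.
apply: one_plusM => //.
have ei : eps i = e.
  by move: (A_bip Aki) ek; case: (eps i) (eps k) (e) => [] [] [].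
(* By [A_sym], [A i k] is positive, so [z1 y i] contains at least one factor [1 + y k]; the
   remaining ones go into the cofactor. *)
exists (fun y => w i y * (1 + y k) ^+ (A i k).-1).
  apply: reg_inM => //; first exact: reg_inW (reg_w ei).
  by apply: reg_inX => //; apply: reg_inW reg_in_1Dk => c ->; exact: lexx.
move=> y y0; rewrite z1E // mulrCA -exprS prednK // lt0n; exact: A_sym.
Qed.

(** Since [z2 y k = (y k)^-1 * (1 + (1 + y k) * S y)], adding 1 gives
    [(1 + y k) * (y k)^-1 * (1 + S y)]: a simple zero along the hyperplane, with cofactor nonzero at
    [pt]. *)
Let reg_1z2k : exists2 s, reg_in pt nz s &
  forall y, posv y -> 0 < s y /\ 1 + z2 y k = (1 + y k) * s y.
Proof.
have [S rS HS] := one_plus_E; exists (fun y => (y k)^-1 * (1 + S y)).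
  by apply: reg_inM => //; apply: (reg_inW pos_nz); exact: reg_in1D.
move=> y y0; have yk := y0 k.
have E : 1 + z2 y k = (1 + y k) * ((y k)^-1 * (1 + S y)).
  by rewrite z2E // HS //; field; rewrite gt_eqF.
split=> //; rewrite -(pmulr_rgt0 _ (_ : 0 < 1 + y k)) ?addr_gt0 // -E.
by rewrite addr_gt0 //; do 2!apply: ystep_pos.
Qed.

(** For [eps i = e], the third step divides by [z1 y i], which contains [(1 + y k) ^+ A i k]; the
    same power occurs in [(1 + z2 y k) ^+ A i k] and cancels it. The other coordinates are those of
    [z2]. *)
Lemma ystep3_regular i : exists2 c, c != 0 & regular_at (minus_one_at R k)
  (fun y => ystep e (ystep (~~ e) (ystep e y)) i) c.
Proof.
change (reg_in pt nz (fun y => z3 y i)).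
have [ei|ei] := eqVneq (eps i) e; last first.
  apply: (@reg_in_ext _ _ _ _ (fun y => z2 y i)).
    by move=> y _; rewrite /z3 ystep_fix.
  by have [->|ik] := eqVneq i k; [exact: reg_z2k|exact/(reg_inW pos_nz)/reg_z2].
have [s rs Hs] := reg_1z2k.
apply: (@reg_in_ext _ _ _ _ (fun y => (w i y)^-1 *
          (s y ^+ A i k * \prod_(j | j != k) (1 + z2 y j) ^+ A i j))).
  move=> y y0; have [s0 sE] := Hs _ y0; rewrite /z3 ystep_mut //.
  have -> : z2 y i = z1 y i by rewrite /z2 ystep_fix // ei; case: (e).
  rewrite z1E // [in RHS](bigD1 k) //= sE exprMn; set P := \prod_(_ | _) _.
  have ne0 : (1 + y k) ^+ A i k != 0 by rewrite expf_neq0 // gt_eqF // addr_gt0.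
  by field; rewrite ne0 gt_eqF // w_gt0.
apply: reg_inM => //.
  apply: reg_inV => //; [by move=> y; exact: w_gt0|exact/(reg_inW pos_nz)/reg_w].
apply: reg_inM => //; first exact: reg_inX.
apply: (reg_inW pos_nz); apply: reg_in_prod => // j jk.
have [->|Aij] := eqVneq (A i j) 0%N.
  by apply: reg_in_ext (reg_in1 pt pos1) => y _; rewrite expr0.
apply: reg_inX => //; apply: reg_in1D; apply: (reg_inW pos_nneg).
by apply: reg_z2 => //; rewrite eq_sym -ei; exact: A_bip.
Qed.

End RegularAtMinusOne.

(** The two hypotheses play different parts: the second limits the possible denominators to powers
    of [1 + y k] with [eps k != e]; the first makes the composite regular at [minus_one_at R k], as
    the three steps have nonzero values there. *)
Lemma laurent_ystep3 e f : laurent f ->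
  laurent (fun y => f (ystep e (ystep (~~ e) y))) ->
  laurent (fun y => f (ystep e (ystep (~~ e) (ystep e y)))).
Proof.
move=> [F [m [pF HF]]] /(laurent_ystep_denominators e)[d de ld].
apply: laurent_clear_denominators ld _ => k /de ek.
have reg_z i := ystep3_regular ek i.
suff : reg_in (minus_one_at R k) (fun=> True)
    (fun y => f (ystep e (ystep (~~ e) (ystep e y)))).
  by case=> c _ rc; exists c.
pose Z y := ystep e (ystep (~~ e) (ystep e y)).
have Zpos y : posv y -> posv (Z y) by move=> y0; do 3!apply: ystep_pos.
apply: (@reg_in_ext _ _ _ _ (fun y => F (Z y) * (\prod_i (Z y i)^-1) ^+ m)).
  move=> y y0; rewrite -HF; last exact: Zpos.
  rewrite prodfV exprVn mulfK // expf_neq0 // gt_eqF //.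
  by apply: prodr_gt0 => i _; exact: Zpos.
apply: reg_inM => //.
  apply: (@polyfun_subst _ _ _ (reg_in (minus_one_at R k) (fun=> True)) Z F) => //.
  - by move=> c; exists c => //; exact: reg_const.
  - by move=> u v [c _ ru] [c' _ rv]; exists (c + c') => //; exact: regD.
  - exact: reg_inM.
  - by move=> i; have [c _ rc] := reg_z i; exists c.
apply: reg_inX => //; apply: reg_in_prod => // i _.
have [c c0 rc] := reg_z i; exists c^-1 => //; apply: regV => // y y0.
by rewrite gt_eqF // Zpos.
Qed.

(** Strong induction on the length: equal adjacent letters cancel by [ystepK], and an alternating
    word of length at least 3 follows from its suffixes with three letters and with one letter
    removed. *)
Lemma laurent_yrun w i : laurent (fun y => yrun w y i).
Proof.
have [s] := ubnP (size w); elim: s w => // s IH [_|e1 w]; first exact: laurent_var.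
case: w => [_|e2 w]; first exact: laurent_ystep.
have [->|e12] := eqVneq e2 e1.
  rewrite !ltnS => sw; apply: laurent_ext (IH w _) => [y y0|].
    by rewrite /= ystepK.
  exact: leq_trans sw.
have -> : e2 = ~~ e1 by case: e1 e2 e12 => [] [].
case: w => [_|e3 w].
  have [ei|ei] := eqVneq (eps i) (~~ e1); last first.
    by apply: laurent_ext (laurent_ystep e1 i) => y _ /=; rewrite [RHS]ystep_fix.
  (* Here [i] is not mutated by the first step, so the inverted coordinate is still the variable
     [y i]. *)
  apply: (@laurent_ext _ _ (fun y => (y i)^-1 *
            \prod_j (1 + ystep e1 y j) ^+ A i j)) => [y _ /=|].
    rewrite [RHS]ystep_mut // [in RHS]ystep_fix // ei; by case: (e1).
  apply: laurentM; first exact: laurentV.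
  apply: laurent_prod => j; apply: laurentX; apply: laurentD.
    exact: laurent_const.
  exact: laurent_ystep.
have [->|e3n] := eqVneq e3 (~~ e1).
  rewrite !ltnS => sw; apply: laurent_ext (IH (e1 :: w) _) => [y y0|].
    by rewrite /= ystepK //; exact: ystep_pos.
  by apply: leq_trans sw; rewrite /= ltnS.
have -> : e3 = e1 by case: e1 e3 e3n {e12} => [] [].
rewrite !ltnS => sw; apply: (laurent_ystep3 (e := e1) (f := fun y => yrun w y i)).
  by apply: IH; apply: leq_trans sw => /=; rewrite ltnS ltnW.
exact: (IH (~~ e1 :: e1 :: w)).
Qed.

End YSystem.

(** * Orders of growth *)

Section Growth.

Variable R : realFieldType.
Implicit Types (g h : R -> R) (d : int) (q r : R).

(** A two-sided bound by a power, uniform on [1 <= q]. The lower bound forces [g] to be positive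
    there, which makes inverses harmless. *)
Definition order_at_infty g d := exists2 C : R, 0 < C &
  forall q, 1 <= q -> q ^ d <= C * g q /\ g q <= C * q ^ d.

Lemma exprz_gt0_ge1 q d : 1 <= q -> 0 < q ^ d.
Proof. by move=> q1; rewrite exprz_gt0 // (lt_le_trans ltr01). Qed.

Lemma order_at_infty_gt0 g d q : order_at_infty g d -> 1 <= q -> 0 < g q.
Proof.
move=> [C C0 H] q1; have [le1 _] := H q q1.
by rewrite -(pmulr_rgt0 _ C0) (lt_le_trans _ le1) // exprz_gt0_ge1.
Qed.

Lemma order_at_infty_ext g h d :
  (forall q, 1 <= q -> g q = h q) -> order_at_infty g d -> order_at_infty h d.
Proof. by move=> gh [C C0 H]; exists C => // q q1; rewrite -gh //; exact: H. Qed.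

Lemma order_at_inftyM g h d c : order_at_infty g d -> order_at_infty h c ->
  order_at_infty (fun q => g q * h q) (d + c).
Proof.
move=> og oh; move: (og) (oh) => [C C0 H] [D D0 K].
exists (C * D); first exact: mulr_gt0.
move=> q q1; have [H1 H2] := H _ q1; have [K1 K2] := K _ q1.
have q0 : q != 0 by rewrite gt_eqF // (lt_le_trans ltr01).
rewrite expfzDr // ![C * D * _]mulrACA; split.
  by apply: ler_pM => //; rewrite ltW // exprz_gt0_ge1.
apply: ler_pM => //; rewrite ltW //.
  exact: order_at_infty_gt0 og q1.
exact: order_at_infty_gt0 oh q1.
Qed.

Lemma order_at_infty_cst c : 0 < c -> order_at_infty (fun=> c) 0.
Proof.
move=> c0; exists (c + c^-1); first by rewrite addr_gt0 ?invr_gt0.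
move=> q _; rewrite expr0z mulr1 mulrDl mulVf ?gt_eqF //; split.
  by rewrite lerDr mulr_ge0 // ltW.
by rewrite lerDl ltW // invr_gt0.
Qed.

Lemma order_at_infty_exprz d : order_at_infty (fun q => q ^ d) d.
Proof. by exists 1 => // q _; rewrite !mul1r. Qed.

Lemma order_at_inftyV g d :
  order_at_infty g d -> order_at_infty (fun q => (g q)^-1) (- d).
Proof.
move=> og; move: (og) => [C C0 H]; exists C => // q q1; have [H1 H2] := H _ q1.
have g0 := order_at_infty_gt0 og q1; have qd0 := exprz_gt0_ge1 d q1.
rewrite -invr_expz; split.
  by rewrite ler_pdivlMr // mulrC ler_pdivrMr.
by rewrite ler_pdivlMr // mulrC ler_pdivrMr.
Qed.

(** Positivity excludes cancellation, so addition turns into a maximum; this is the source of the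
    truncation in [tstep]. *)
Lemma order_at_infty1D g d :
  order_at_infty g d -> order_at_infty (fun q => 1 + g q) (Num.max d 0).
Proof.
move=> og; move: (og) => [C C0 H]; exists (C + 1); first by rewrite addr_gt0.
move=> q q1; have [H1 H2] := H _ q1; have g0 := order_at_infty_gt0 og q1.
have led : q ^ d <= q ^ Num.max d 0 by rewrite ler_weXz2l // le_max lexx.
have le0 : 1 <= q ^ Num.max d 0 by rewrite -(expr0z q) ler_weXz2l // le_max lexx orbT.
split; last by rewrite mulrDl mul1r addrC lerD // (le_trans H2) // ler_wpM2l // ltW.
have Cg := mulr_gt0 C0 g0; rewrite mulrDl !mulrDr mul1r.
by case: (leP d 0) => _; rewrite ?expr0z; move: H1; nra.
Qed.

Lemma order_at_inftyX g d m :
  order_at_infty g d -> order_at_infty (fun q => g q ^+ m) (m%:Z * d).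
Proof.
move=> og; elim: m => [|m IH].
  by rewrite mul0r; apply: order_at_infty_ext (order_at_infty_cst ltr01).
have -> : m.+1%:Z * d = d + m%:Z * d by rewrite -addn1 PoszD mulrDl mul1r addrC.
by apply: order_at_infty_ext (order_at_inftyM og IH) => q _; rewrite exprS.
Qed.

Lemma order_at_infty_prod (I : Type) (s : seq I) (G : I -> R -> R) (d : I -> int) :
  (forall i, order_at_infty (G i) (d i)) ->
  order_at_infty (fun q => \prod_(i <- s) G i q) (\sum_(i <- s) d i).
Proof.
move=> oG; elim: s => [|i s IH].
  rewrite big_nil; apply: order_at_infty_ext (order_at_infty_cst ltr01) => q _.
  by rewrite big_nil.
rewrite big_cons; apply: order_at_infty_ext (order_at_inftyM (oG i) IH) => q _.
by rewrite big_cons.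
Qed.

(** If [c < d], the bound at [q = 1 + C] would give [1 + C <= C]. *)
Lemma exprz_bound_le (d c : int) (C : R) :
  (forall q, 1 <= q -> q ^ d <= C * q ^ c) -> d <= c.
Proof.
move=> H; rewrite leNgt; apply/negP => ltcd.
have C0 : 0 <= C by have := H _ (lexx _); rewrite !exp1rz; lra.
have q1 : 1 <= 1 + C by rewrite lerDl.
have q0 : 0 < 1 + C by rewrite (lt_le_trans ltr01).
have : (1 + C) ^ (1 + c) <= C * (1 + C) ^ c.
  by apply: le_trans (H _ q1); rewrite ler_weXz2l // addrC lezD1.
by rewrite expfzDr ?gt_eqF // expr1z ler_pM2r ?exprz_gt0_ge1 // gerDr leNgt ltr01.
Qed.

Lemma coef_poly_bounded (p : {poly R}) (d : int) (C : R) :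
  (forall q, 1 <= q -> `|p.[q]| <= C * q ^ d) ->
  forall a : nat, d < a%:Z -> p`_a = 0.
Proof.
move=> H a lta; have [-> | p0] := eqVneq p 0; first by rewrite coef0.
suff lesd : ((size p).-1%:Z <= d).
  apply: nth_default; rewrite -(prednK (_ : 0 < size p)%N) ?size_poly_gt0 //.
  by rewrite -ltz_nat (le_lt_trans lesd).
pose N := (size p).-1; pose l := `|lead_coef p|.
have l0 : 0 < l by rewrite normr_gt0 lead_coef_eq0.
rewrite leNgt; apply/negP => ltdN.
pose M := \sum_(i < N) `|p`_i|.
(* If the degree [N] exceeded [d], the leading term [l * q ^ N] would be at most
   [(M + C) * q ^ (N - 1)]; dividing by [q ^ N] compares the exponents 0 and -1. *)
suff : (0 : int) <= - 1 by [].
apply: (@exprz_bound_le _ _ (l^-1 * (M + C))) => q q1.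
have q0 : 0 < q by rewrite (lt_le_trans ltr01).
rewrite -(ler_pM2r (exprz_gt0_ge1 N%:Z q1)) -mulrA -!expfzDr ?gt_eqF // add0r.
rewrite -mulrA ler_pdivlMl // mulrDl.
have pq : p.[q] = \sum_(i < N) p`_i * q ^+ i + lead_coef p * q ^+ N.
  by rewrite horner_coef -(prednK (_ : 0 < size p)%N) ?size_poly_gt0 // big_ord_recr.
have -> : l * q ^ N%:Z = `|p.[q] - \sum_(i < N) p`_i * q ^+ i|.
  rewrite pq addrAC subrr add0r normrM; congr (_ * _).
  by rewrite ger0_norm // exprn_ge0 // ltW.
rewrite (le_trans (ler_normB _ _)) // addrC lerD //.
  rewrite (le_trans (ler_norm_sum _ _ _)) // mulr_suml ler_sum // => i _.
  rewrite normrM ler_wpM2l // ger0_norm ?exprn_ge0 ?(ltW q0) //.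
  rewrite -[q ^+ i]/(q ^ i%:Z) ler_weXz2l //.
  by rewrite -(lerD2l 1) addrA addrN add0r addrC lezD1 ltz_nat.
rewrite (le_trans (H _ q1)) //; apply: ler_wpM2l.
  by have := H _ (lexx _); rewrite exp1rz mulr1; apply: le_trans.
by rewrite ler_weXz2l // -(lerD2l 1) addrA addrN add0r addrC lezD1.
Qed.

(** The outer variable of [B] is evaluated at [r] and the inner one at [q], so the coefficient of
    [q ^+ a * r ^+ b] is entry [a] of entry [b]. *)
Definition laurent2 (G : R * R -> R) := exists (B : {poly {poly R}}) (N : nat),
  forall q r, 0 < q -> 0 < r -> G (q, r) * (q * r) ^+ N = B.[r, q].

Lemma laurent2_ext (G H : R * R -> R) :
  (forall q r, 0 < q -> 0 < r -> G (q, r) = H (q, r)) ->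
  laurent2 G -> laurent2 H.
Proof.
move=> GH [B [N HB]]; exists B, N => q r q0 r0.
by rewrite -GH ?HB.
Qed.

Lemma laurent2_cst c : laurent2 (fun=> c).
Proof. by exists c%:P%:P, 0 => q r _ _; rewrite expr0 mulr1 !hornerC. Qed.

Lemma laurent2D (G H : R * R -> R) :
  laurent2 G -> laurent2 H -> laurent2 (fun t => G t + H t).
Proof.
move=> [B [N HB]] [C [M HC]].
exists (B * ('X * 'Y) ^+ M + C * ('X * 'Y) ^+ N), (N + M)%N => q r q0 r0.
have E K : (('X * 'Y : {poly {poly R}}) ^+ K).[r, q] = (q * r) ^+ K.
  by rewrite !hornerE [r * q]mulrC.
by rewrite !(hornerD, hornerM) !E -HB // -HC // exprD; ring.
Qed.

Lemma laurent2M (G H : R * R -> R) :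
  laurent2 G -> laurent2 H -> laurent2 (fun t => G t * H t).
Proof.
move=> [B [N HB]] [C [M HC]]; exists (B * C), (N + M)%N => q r q0 r0.
by rewrite !hornerM -HB // -HC // exprD; ring.
Qed.

Lemma laurent2_monomial (d c : int) : laurent2 (fun t => t.1 ^ d * t.2 ^ c).
Proof.
have absD (b : int) : exists m : nat, b + `|b|%N%:Z = m%:Z.
  by case: b => m; [exists (m + m)%N|exists 0%N]; rewrite ?NegzE //= ?addNr.
have [m Hm] := absD d; have [l Hl] := absD c.
(* One common power of [q * r] must clear both negative exponents, whence the extra [c] on the side
   of [q] and the extra [d] on that of [r]. *)
exists ('Y ^+ (m + `|c|) * 'X ^+ (l + `|d|)), (`|d| + `|c|)%N => q r q0 r0.
rewrite /= !hornerE exprMn.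
have E (x : R) (b : int) (k : nat) : 0 < x -> b + `|b|%N%:Z = k%:Z ->
    x ^ b * x ^+ `|b| = x ^+ k.
  by move=> x0 bk; rewrite -[x ^+ `|b|]/(x ^ `|b|%N%:Z) -expfzDr ?gt_eqF // bk.
rewrite !exprD -(E _ _ _ q0 Hm) -(E _ _ _ r0 Hl); ring.
Qed.

(** The constant may depend on [r]: for each fixed [r] the coefficient of [q ^+ a] vanishes, and as
    a polynomial in [r] it then has infinitely many roots. *)
Lemma bipoly_coef_bounded (B : {poly {poly R}}) (d : int) :
  (forall r, 1 <= r -> exists C, forall q, 1 <= q -> `|B.[r, q]| <= C * q ^ d) ->
  forall a b : nat, d < a%:Z -> B`_b`_a = 0.
Proof.
move=> H a b lta; suff : (swapXY B)`_a = 0.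
  by move/(congr1 (fun p : {poly R} => p`_b)); rewrite coef_swapXY coef0.
apply: (@poly_eq0_inj R _ (fun k : nat => 1 + k%:R)) => [k l /addrI/eqP|k].
  by rewrite eqr_nat => /eqP.
have r1 : 1 <= 1 + k%:R :> R by rewrite lerDl.
have [C HC] := H _ r1.
have := coef_poly_bounded HC lta.
by rewrite -[B]swapXYK horner_swapXY coef_map swapXYK.
Qed.

(** The orders in [q] and in [r] bound the two partial degrees of the cleared polynomial [B], hence
    its growth on the diagonal. Its coefficients may have any sign, so only an upper bound
    results. *)
Lemma order_at_infty_subadd (G : R * R -> R) (d1 d2 d : int) :
  laurent2 G ->
  (forall r, 1 <= r -> order_at_infty (fun q => G (q, r)) d1) ->
  (forall q, 1 <= q -> order_at_infty (fun r => G (q, r)) d2) ->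
  order_at_infty (fun q => G (q, q)) d -> d <= d1 + d2.
Proof.
move=> [B [N HB]] O1 O2 O.
have pos q : 1 <= q -> 0 < q by apply: lt_le_trans.
have B1 : forall a b : nat, d1 + N%:Z < a%:Z -> B`_b`_a = 0.
  apply: bipoly_coef_bounded => r r1; have [C C0 HC] := O1 _ r1.
  exists (C * r ^+ N) => q q1; have [_ leG] := HC _ q1.
  have G0 := order_at_infty_gt0 (O1 _ r1) q1.
  rewrite -HB ?pos // ger0_norm; last first.
    by rewrite mulr_ge0 ?exprn_ge0 ?mulr_ge0 // ltW // pos.
  rewrite (_ : C * _ * _ = C * q ^ d1 * (q * r) ^+ N).
    by rewrite ler_wpM2r // exprn_ge0 // mulr_ge0 // ltW // pos.
  by rewrite expfzDr ?gt_eqF ?pos // exprMn -[q ^+ N]/(q ^ N%:Z); ring.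
have B2 : forall a b : nat, d2 + N%:Z < b%:Z -> B`_b`_a = 0.
  move=> a b ltb; rewrite -coef_swapXY; move: b a ltb.
  move=> b a; apply: bipoly_coef_bounded => q q1; have [C C0 HC] := O2 _ q1.
  exists (C * q ^+ N) => r r1; have [_ leG] := HC _ r1.
  have G0 := order_at_infty_gt0 (O2 _ q1) r1.
  rewrite horner2_swapXY -HB ?pos // ger0_norm; last first.
    by rewrite mulr_ge0 ?exprn_ge0 ?mulr_ge0 // ltW // pos.
  rewrite (_ : C * _ * _ = C * r ^ d2 * (q * r) ^+ N).
    by rewrite ler_wpM2r // exprn_ge0 // mulr_ge0 // ltW // pos.
  by rewrite expfzDr ?gt_eqF ?pos // exprMn -[r ^+ N]/(r ^ N%:Z); ring.
have [C C0 HC] := O.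
pose S := \sum_(b < size B) \sum_(a < size B`_b) `|B`_b`_a|.
suff : d + (N%:Z + N%:Z) <= (d1 + N%:Z) + (d2 + N%:Z) by lia.
apply: (@exprz_bound_le _ _ (C * S)) => q q1; have q0 := pos _ q1.
have qne : q != 0 by rewrite gt_eqF.
have [led _] := HC _ q1.
have -> : q ^ (d + (N%:Z + N%:Z)) = q ^ d * (q * q) ^+ N.
  by rewrite !expfzDr // exprMn.
apply: (@le_trans _ _ (C * (G (q, q) * (q * q) ^+ N))).
  by rewrite mulrA ler_wpM2r // exprn_ge0 // mulr_ge0 // ltW.
rewrite HB // -mulrA ler_wpM2l ?(ltW C0) // (horner_coef B) horner_sum mulr_suml.
apply: ler_sum => b _; rewrite hornerM -polyC_exp hornerC horner_coef !mulr_suml.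
apply: ler_sum => a _.
have [lta|lea] := ltP (d1 + N%:Z) a%:Z; first by rewrite B1 // normr0 !mul0r.
have [ltb|leb] := ltP (d2 + N%:Z) b%:Z; first by rewrite B2 // normr0 !mul0r.
rewrite -mulrA; apply: (@le_trans _ _ (`|B`_b`_a| * (q ^+ a * q ^+ b))).
  by rewrite ler_wpM2r ?ler_norm // mulr_ge0 // exprn_ge0 // ltW.
rewrite ler_wpM2l // [X in _ <= X]expfzDr //.
by apply: ler_pM; rewrite ?exprn_ge0 ?(ltW q0) // exprnP ler_weXz2l.
Qed.

End Growth.

(** * Tropicalisation *)

Section Tropical.

Variables (R : realFieldType) (n : nat) (eps : 'I_n -> bool).
Variable A : 'I_n -> 'I_n -> nat.
Implicit Types (u v : 'I_n -> int) (i j : 'I_n) (e : bool) (w : seq bool).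

Definition tstep e u : 'I_n -> int := fun i =>
  if eps i == e then - u i + \sum_j (A i j)%:Z * Num.max (u j) 0 else u i.

Definition trun w u := foldl (fun v e => tstep e v) u w.

(** A step uses only products, inverses and [1 + y], so [tstep] computes its effect on orders at
    infinity. *)
Lemma order_yrun w (Y : R -> 'I_n -> R) u :
  (forall i, order_at_infty (fun q => Y q i) (u i)) ->
  forall i, order_at_infty (fun q => yrun eps A w (Y q) i) (trun w u i).
Proof.
elim: w Y u => //= e w IH Y u oY; apply: (IH (fun q => ystep eps A e (Y q))).
move=> i; rewrite /ystep /tstep; case: ifP => // _.
apply: order_at_inftyM; first exact: order_at_inftyV.
by apply: order_at_infty_prod => j; apply/order_at_inftyX/order_at_infty1D.
Qed.

Lemma laurent2_monomial_curve (f : ('I_n -> R) -> R) u v : laurent f ->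
  laurent2 (fun t => f (fun i => t.1 ^ u i * t.2 ^ v i)).
Proof.
move=> [p [m [pp Hp]]]; pose Y (t : R * R) i := t.1 ^ u i * t.2 ^ v i.
(* The inverse of the product of the coordinates is itself a monomial, so the denominator of [f]
   stays Laurent in two variables. *)
pose M (t : R * R) := \prod_i (t.1 ^ (- u i) * t.2 ^ (- v i)).
apply: (@laurent2_ext _ (fun t => p (Y t) * M t ^+ m)) => [q r q0 r0|].
  have Y0 : posv (Y (q, r)) by move=> i; rewrite mulr_gt0 // exprz_gt0.
  rewrite -Hp // -mulrA -exprMn -big_split big1 ?expr1n ?mulr1 //= => i _.
  by rewrite /Y /= -!invr_expz mulrACA !mulfV ?mulr1 // gt_eqF // exprz_gt0.
apply: laurent2M.
  apply: polyfun_subst pp; [exact: laurent2_cst|exact: laurent2D|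
    exact: laurent2M|by move=> i; exact: laurent2_monomial].
have lM : laurent2 M.
  rewrite /M; elim: (index_enum _) => [|i s IH].
    apply: (@laurent2_ext R (fun=> 1)); last exact: laurent2_cst.
    by move=> q r _ _; rewrite big_nil.
  have := laurent2M (laurent2_monomial R (- u i) (- v i)) IH.
  apply: laurent2_ext.
  by move=> q r _ _; rewrite big_cons.
elim: m {Hp} => [|m IH].
  apply: (@laurent2_ext R (fun=> 1)); last exact: laurent2_cst.
  by move=> q r _ _; rewrite expr0.
have := laurent2M lM IH; apply: laurent2_ext => q r _ _.
by rewrite exprS.
Qed.

Hypothesis A_bip : forall i j, A i j != 0%N -> eps i != eps j.
Hypothesis A_sym : forall i j, A i j != 0%N -> A j i != 0%N.

Lemma trun_subadd w u v i :
  trun w (fun j => u j + v j) i <= trun w u i + trun w v i.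
Proof.
apply: (order_at_infty_subadd (G := fun t : R * R =>
          yrun eps A w (fun j => t.1 ^ u j * t.2 ^ v j) i)).
- apply: (laurent2_monomial_curve (f := fun y => yrun eps A w y i)).
  exact: laurent_yrun.
(* With [r] fixed, [r ^ v j] is a positive constant and has order 0 in [q]. *)
- move=> r r1; apply: order_yrun => j /=; rewrite -[X in order_at_infty _ X]addr0.
  apply: order_at_inftyM; first exact: order_at_infty_exprz.
  by apply: order_at_infty_cst; exact: exprz_gt0_ge1.
- move=> q q1; apply: order_yrun => j /=; rewrite -[X in order_at_infty _ X]add0r.
  apply: order_at_inftyM; last exact: order_at_infty_exprz.
  by apply: order_at_infty_cst; exact: exprz_gt0_ge1.
- apply: order_yrun => j /=.
  by apply: order_at_inftyM; exact: order_at_infty_exprz.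
Qed.

End Tropical.

(** * The piecewise linear maps tau *)

Section Tau.

Variables (R : realType) (V : vectType R) (dot : {dot V for idfun}).
Variables (Phi : seq V) (n : nat) (Pi : n.-tuple V) (eps : 'I_n -> bool).
Hypotheses (rootPhi : root_system dot Phi) (simplePi : simple_roots Phi Pi).
Hypothesis bip : coxeter_bipartition dot Pi eps.
Implicit Types (x : V) (i j : 'I_n) (e : bool) (w : seq bool).

Lemma eq_coord x x' : (forall i, coord Pi i x = coord Pi i x') -> x = x'.
Proof.
move=> H; have bP := simple_basis simplePi.
rewrite (coord_basis bP (memvf x)) (coord_basis bP (memvf x')).
by apply: eq_bigr => i _; rewrite H.
Qed.

Lemma coord_comb (c : 'I_n -> R) i :
  coord Pi i (\sum_(j < n) c j *: tnth Pi j) = c i.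
Proof.
under eq_bigr => j _ do rewrite (tnth_nth 0).
by apply: coord_sum_free; exact: basis_free (simple_basis simplePi).
Qed.

Lemma coord_simple i j : coord Pi i (tnth Pi j) = (j == i)%:R.
Proof.
rewrite (tnth_nth 0); apply: coord_free.
exact: basis_free (simple_basis simplePi).
Qed.

Lemma simple_root i : tnth Pi i \in Phi.
Proof. by apply: (simple_sub simplePi); exact: mem_tnth. Qed.

Lemma dot_simple_gt0 i : 0 < dot (tnth Pi i) (tnth Pi i).
Proof.
apply: neq0_dnorm_gt0; apply: contraNneq (root_neq0 rootPhi) => <-.
exact: simple_root.
Qed.

Lemma cartan_eq0_sym i j : cartan dot Pi i j = 0 -> cartan dot Pi j i = 0.
Proof.
move=> /eqP; rewrite /cartan !mulf_eq0 invr_eq0 (gt_eqF (dot_simple_gt0 i)).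
rewrite pnatr_eq0 orbF /= => /eqP dij.
by rewrite hermC /= dij !(mulr0, mul0r).
Qed.

(** The reflected root has coefficient 1 at the simple root [j], so it is positive; its coefficient
    at [i] is the negated Cartan entry. *)
Lemma cartan_npos i j : i != j -> exists m : nat, cartan dot Pi i j = - m%:R.
Proof.
move=> ij; have := root_reflection rootPhi (simple_root i) (simple_root j).
have E k : coord Pi k (reflection dot (tnth Pi i) (tnth Pi j)) =
           (j == k)%:R - cartan dot Pi i j * (i == k)%:R.
  by rewrite /reflection linearB linearZ /= !coord_simple.
move/(simple_sign simplePi) => [/(_ i)|/(_ j)].
  rewrite E eqxx eq_sym (negPf ij) sub0r mulr1 => /natrP[m Hm].
  by exists m; rewrite -Hm opprK.
rewrite E eqxx (negPf ij) mulr0 subr0 => /natrP[m Hm].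
have : 0 <= m%:R :> R by [].
by rewrite -Hm lerNr oppr0 leNgt ltr01.
Qed.

Lemma coord_tau e x i : coord Pi i (tau dot Pi eps e x) =
  if eps i == e then
    - coord Pi i x
    - \sum_(j < n | j != i) cartan dot Pi i j * Num.max (coord Pi j x) 0
  else coord Pi i x.
Proof. exact: coord_comb. Qed.

Lemma tauK e : involutive (tau dot Pi eps e).
Proof.
move=> x; apply: eq_coord => i; rewrite !coord_tau.
case: (boolP (eps i == e)) => // /eqP ei.
rewrite opprB opprK -addrA; set S := \sum_(_ | _) _; set T := \sum_(_ | _) _.
suff -> : T = S by rewrite addrC subrK.
rewrite /S /T; apply: eq_bigr => j ji.
have [->|aij] := eqVneq (cartan dot Pi i j) 0; first by rewrite !mul0r.
rewrite eq_sym in ji; have := bip ji aij.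
by rewrite coord_tau ei eq_sym => /negPf ->.
Qed.

Definition taurun w x := foldl (fun z e => tau dot Pi eps e z) x w.

Lemma taurunK w : cancel (taurun w) (taurun (rev w)).
Proof.
elim: w => // e w IH x /=.
by rewrite /taurun rev_cons -cats1 foldl_cat /= -/(taurun _ _) -/(taurun _ _) IH tauK.
Qed.

(** Each [tau] is an involution, so the inverse of a word is the reversed word. *)
Lemma tau_group_run s :
  tau_group dot Pi eps s -> exists w, forall x, s x = taurun w x.
Proof.
elim=> [|e|s1 s2 _ [w1 H1] _ [w2 H2]|s1 s2 _ [w1 H1] K1 K2].
- by exists [::].
- by exists [:: e].
- by exists (w2 ++ w1) => x; rewrite /taurun foldl_cat /= H1 H2.
- by exists (rev w1) => x; rewrite -[in RHS](K2 x) H1 taurunK.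
Qed.

Variable A : 'I_n -> 'I_n -> nat.
Hypothesis AE : forall i j, i != j -> cartan dot Pi i j = - (A i j)%:R.
Hypothesis A0 : forall i, A i i = 0%N.

(** On the root lattice [tau] is the tropical step for the negated off-diagonal Cartan entries. *)
Lemma coord_taurun w x (u : 'I_n -> int) :
  (forall i, coord Pi i x = (u i)%:~R) ->
  forall i, coord Pi i (taurun w x) = (trun eps A w u i)%:~R.
Proof.
elim: w x u => //= e w IH x u xu; apply: IH => i.
rewrite coord_tau /tstep; case: ifP => // _.
rewrite rmorphD rmorphN /= -xu; congr (_ + _).
rewrite rmorph_sum /= [in RHS](bigD1 i) //= A0 mul0r add0r -sumrN.
apply: eq_bigr => j ji; rewrite AE 1?eq_sym // mulNr opprK xu rmorphM /=.
congr (_ * _); have [ge0|le0] := lerP (u j) 0.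
  by rewrite max_r // lerz0.
by rewrite max_l // ler0z ltW.
Qed.

End Tau.

(** * Application to almost positive roots *)

Lemma almost_positive_root_int_coord (R : realType) (V : vectType R)
    (Phi : seq V) (n : nat) (Pi : n.-tuple V) (b : V) :
  simple_roots Phi Pi -> almost_positive_root Phi Pi b ->
  forall i : 'I_n, exists u : int, coord Pi i b = u%:~R.
Proof.
move=> sP /orP[/andP[bPhi _]|/existsP[j /eqP ->]] i.
  have [/(_ i)/natrP[m ->]|/(_ i)/natrP[m Hm]] := simple_sign sP bPhi.
    by exists m.
  by exists (- m%:Z); rewrite rmorphN /= -[LHS]opprK Hm.
exists (- (j == i)%:Z); rewrite linearN /= (coord_simple sP) rmorphN /=.
by case: (j == i).
Qed.

Theorem theorem1p17 (R : realType) (V : vectType R)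
    (dot : {dot V for idfun}) (Phi : seq V) (n : nat) (Pi : n.-tuple V)
    (eps : 'I_n -> bool) (deg : V -> V -> nat) (a a' y : V) :
  root_system dot Phi ->
  irreducible_roots dot Phi ->
  simple_roots Phi Pi ->
  coxeter_bipartition dot Pi eps ->
  compatibility_degree dot Phi Pi eps deg ->
  almost_positive_root Phi Pi a ->
  almost_positive_root Phi Pi a' ->
  deg a a' = 1%N ->
  deg a' a = 1%N ->
  is_boxplus dot Pi eps a a' y ->
  forall i : 'I_n, 0 < coord Pi i y -> 0 < coord Pi i (a + a').
Proof.
move=> rootPhi _ simplePi bip _ aP aP' _ _; rewrite /is_boxplus.
case: eqP => [_ -> i|_ [[s [t [sG st ts ->]]] _] i]; first by rewrite linear0 ltxx.
(* This inequality holds at every coordinate, whatever its sign. *)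
suff : coord Pi i (s (t a + t a')) <= coord Pi i (a + a').
  by move=> le1 lt1; exact: lt_le_trans le1.
have [A HA] : exists A : 'I_n -> 'I_n -> nat,
    forall i j, if i == j then A i j = 0%N else cartan dot Pi i j = - (A i j)%:R.
  have HA i1 : exists A : 'I_n -> nat, forall j,
      if i1 == j then A j = 0%N else cartan dot Pi i1 j = - (A j)%:R.
    apply: (fin_all_exists (P := fun j m => if i1 == j then m = 0%N else
      cartan dot Pi i1 j = - m%:R)) => j.
    have [_|ij] := eqVneq i1 j; first by exists 0%N.
    exact: (cartan_npos rootPhi simplePi ij).
  exact: fin_all_exists HA.
have A0 j : A j j = 0%N by have := HA j j; rewrite eqxx.
have AE j k : j != k -> cartan dot Pi j k = - (A j k)%:R.
  by move=> /negPf jk; have := HA j k; rewrite jk.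
have A_neq j k : A j k != 0%N -> j != k.
  by apply: contra_neq => ->; exact: A0.
have A_bip j k : A j k != 0%N -> eps j != eps k.
  move=> Ajk; apply: bip; first exact: A_neq.
  by rewrite AE ?A_neq // oppr_eq0 pnatr_eq0.
have A_sym j k : A j k != 0%N -> A k j != 0%N.
  move=> Ajk; have jk := A_neq _ _ Ajk; apply: contraNneq Ajk => Akj.
  have : cartan dot Pi k j = 0 by rewrite AE 1?eq_sym // Akj oppr0.
  move/(cartan_eq0_sym rootPhi simplePi)/eqP.
  by rewrite AE // oppr_eq0 pnatr_eq0.
have [u Hu] := fin_all_exists (almost_positive_root_int_coord simplePi aP).
have [u' Hu'] := fin_all_exists (almost_positive_root_int_coord simplePi aP').
have [w Hs] := tau_group_run simplePi bip sG.
(* Writing [t] as a word too shows that [t a] and [t a'] have integer coordinates. *)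
have Ht x : t x = taurun dot Pi eps (rev w) x.
  by rewrite -[in RHS](ts x) Hs (taurunK simplePi bip).
have tu := coord_taurun eps simplePi AE A0 (rev w) Hu.
have tu' := coord_taurun eps simplePi AE A0 (rev w) Hu'.
(* With [a = s (t a)] and [a' = s (t a')], the claim becomes subadditivity of the word [w] at the
   coordinates of [t a] and [t a']. *)
have coordE x : coord Pi i x = coord Pi i (s (t x)) by rewrite ts.
rewrite linearD /= (coordE a) (coordE a') !Hs !Ht.
rewrite (coord_taurun eps simplePi AE A0 w tu i).
rewrite (coord_taurun eps simplePi AE A0 w tu' i).
rewrite (coord_taurun eps simplePi AE A0 w
  (u := fun j => trun eps A (rev w) u j + trun eps A (rev w) u' j)) => [|j].
  by rewrite -rmorphD /= ler_int; exact: (trun_subadd R).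
by rewrite linearD /= tu tu' rmorphD.
Qed.
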